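(* Let $K\le m$ and $m_1\in[K]$. Consider $$\min_{\mathbf B\in\mathcal B_K}\ \min_{\mathbf x\in\mathcal X}\ \max_{\mathbb P_{\mathrm I}\in\mathcal D_{\mathrm{L2}}}\ \mathbb E_{\mathbb P_{\mathrm I}}\left[f\left(\mathbf x,\mathbf U\boldsymbol\Lambda^{1/2}\boldsymbol\xi_{\mathrm I}+\boldsymbol\mu\right)\right],\tag{P}$$ with $\mathcal D_{\mathrm{L2}}$ as in the context. Replacing the inner maximization problem of (P) by its dual (written out in the context) yields a problem with the same optimal value as the following SDP formulation, whose optimal value is denoted $\Theta_{\mathrm{L2}}(m_1)$: minimize $$s+\gamma_2\,\mathbf I_{m_1}\bullet\mathbf Q_{\mathrm r}'+\sqrt{\gamma_1}\,\|\mathbf q\|_2$$ over $\mathbf x\in\mathcal X$, $s\in\mathbb R$, $\mathbf q\in\mathbb R^m$, $\mathbf Q_{\mathrm r}'\in\mathbb R^{m_1\times m_1}$, $\boldsymbol\lambda_k\in\mathbb R^l_+$, $\mathbf u_k'\in\mathbb R^{m_1}$, $\mathbf u_k''\in\mathbb R^{K-m_1}$ ($k\in[K]$), $\mathbf B_1\in\mathbb R^{m\times m_1}$, $\mathbf B_2\in\mathbb R^{m\times(K-m_1)}$, subject to $[\mathbf B_1,\mathbf B_2]^\top[\mathbf B_1,\mathbf B_2]=\mathbf I_K$ and, for all $k\in[K]$, $$\begin{bmatrix}s-y_k^0(\mathbf x)-\boldsymbol\lambda_k^\top\mathbf b-y_k(\mathbf x)^\top\boldsymbol\mu+\boldsymbol\lambda_k^\top\mathbf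 A\boldsymbol\mu&\frac12(\mathbf u_k')^\top\\ \frac12\mathbf u_k'&\mathbf Q_{\mathrm r}'\end{bmatrix}\succeq0,$$ $$\mathbf q+(\mathbf U\boldsymbol\Lambda^{1/2})^\top(\mathbf A^\top\boldsymbol\lambda_k-y_k(\mathbf x))=\mathbf B_1\mathbf u_k'+\mathbf B_2\mathbf u_k''.$$ In addition, with $\Theta_{\mathrm M}(m)$ the optimal value of the problem (SDP) defined in the context: (i) $\Theta_{\mathrm{L2}}(m_1)\le\Theta_{\mathrm M}(m)$ for any $m_1\le K$; (ii) $\Theta_{\mathrm{L2}}(m_1)\le\Theta_{\mathrm{L2}}(m_2)$ for any $m_1<m_2\le K$; (iii) $\Theta_{\mathrm{L2}}(K)=\Theta_{\mathrm M}(m)$.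
   Context: Setting. $[N]=\{1,\dots,N\}$; $m,n,l,K$ are positive integers; $\gamma_1\ge 0$, $\gamma_2\ge 1$; $\boldsymbol\mu\in\mathbb R^m$; $\boldsymbol\Sigma\in\mathbb R^{m\times m}$ is symmetric positive definite with eigenvalue decomposition $\boldsymbol\Sigma=\mathbf U\boldsymbol\Lambda\mathbf U^\top$, $\mathbf U$ orthogonal, $\boldsymbol\Lambda$ diagonal with nonincreasing diagonal entries. $\mathcal X\subseteq\mathbb R^n$. The support set is $\mathcal S=\{\boldsymbol\xi\in\mathbb R^m: \mathbf A\boldsymbol\xi\le\mathbf b\}$ with $\mathbf A\in\mathbb R^{l\times m}$, $\mathbf b\in\mathbb R^l$, and has at least one interior point. The function $f$ is piecewise linear convex in $\boldsymbol\xi$: $f(\mathbf x,\boldsymbol\xi)=\max_{k\in[K]}\{y_k^0(\mathbf x)+y_k(\mathbf x)^\top\boldsymbol\xi\}$ with $y_k^0(\mathbf x)\in\mathbb R$ and $y_k(\mathbf x)\in\mathbb R^m$ affine in $\mathbf x$. $\mathbf M\succeq0$ means $\mathbf M$ is (symmetric) positive semidefinite, $\preceq$ is the corresponding order; $\mathbf A\bullet\mathbf B=\sum_{i,j}A_{ij}B_{ij}$. Optimal values of min (max) problems are infima (suprema). $\mathcal B_K=\{\mathbf B\in\mathbb R^{m\times K}:\mathbf B^\top\mathbf B=\mathbf I_K\}$; $\mathbf B=[\mathbf B_1,\mathbf B_2]$ with $\mathbf B_1\in\mathbb R^{m\times m_1}$, $\mathbf B_2\in\mathbb R^{m\times(K-m_1)}$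 (when $m_1=K$ the block $\mathbf B_2$ and everything associated with it is absent). $\mathcal S_{\mathrm I}=\{\boldsymbol\xi_{\mathrm I}\in\mathbb R^m:\mathbf U\boldsymbol\Lambda^{1/2}\boldsymbol\xi_{\mathrm I}+\boldsymbol\mu\in\mathcal S\}$. For given $\mathbf B=[\mathbf B_1,\mathbf B_2]\in\mathcal B_K$, $\mathcal D_{\mathrm{L2}}$ is the set of probability distributions $\mathbb P_{\mathrm I}$ of a random vector $\boldsymbol\xi_{\mathrm I}\in\mathbb R^m$ with $\mathbb P_{\mathrm I}(\boldsymbol\xi_{\mathrm I}\in\mathcal S_{\mathrm I})=1$, $\mathbb E_{\mathbb P_{\mathrm I}}[\boldsymbol\xi_{\mathrm I}^\top]\,\mathbb E_{\mathbb P_{\mathrm I}}[\boldsymbol\xi_{\mathrm I}]\le\gamma_1$, $\mathbb E_{\mathbb P_{\mathrm I}}[\mathbf B_1^\top\boldsymbol\xi_{\mathrm I}\boldsymbol\xi_{\mathrm I}^\top\mathbf B_1]\preceq\gamma_2\mathbf I_{m_1}$, $\mathbb E_{\mathbb P_{\mathrm I}}[\mathbf B_2^\top\boldsymbol\xi_{\mathrm I}\boldsymbol\xi_{\mathrm I}^\top\mathbf B_2]\preceq\mathbf 0_{(K-m_1)\times(K-m_1)}$. Dual of the inner maximization problem of (P), for fixed $\mathbf x$ and $\mathbf B$: minimize $s+\gamma_2\mathbf I_{m_1}\bullet\mathbf Q_{\mathrm r}'+\sqrt{\gamma_1}\|\mathbf q\|_2$ over $s\in\mathbb R$, $\mathbf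 q\in\mathbb R^m$, $\mathbf Q_{\mathrm r}'\in\mathbb R^{m_1\times m_1}$, $\mathbf Q_{\mathrm r}''\in\mathbb R^{(K-m_1)\times(K-m_1)}$ with $\mathbf Q_{\mathrm r}'\succeq0$, $\mathbf Q_{\mathrm r}''\succeq0$, subject to $$s\ge f(\mathbf x,\mathbf U\boldsymbol\Lambda^{1/2}\boldsymbol\xi_{\mathrm I}+\boldsymbol\mu)-\boldsymbol\xi_{\mathrm I}^\top\mathbf B_1\mathbf Q_{\mathrm r}'\mathbf B_1^\top\boldsymbol\xi_{\mathrm I}-\boldsymbol\xi_{\mathrm I}^\top\mathbf B_2\mathbf Q_{\mathrm r}''\mathbf B_2^\top\boldsymbol\xi_{\mathrm I}-\mathbf q^\top\boldsymbol\xi_{\mathrm I}\quad\forall\boldsymbol\xi_{\mathrm I}\in\mathcal S_{\mathrm I}.$$ Replacing the inner maximization by this dual means minimizing jointly over $\mathbf B\in\mathcal B_K$, $\mathbf x\in\mathcal X$ and the dual variables. Problem (SDP): minimize $s+\gamma_2\,\mathbf I_m\bullet\mathbf Q+\sqrt{\gamma_1}\,\|\mathbf q\|_2$ over $\mathbf x\in\mathcal X$, $s\in\mathbb R$, $\boldsymbol\lambda_k\in\mathbb R^l_+$ ($k\in[K]$), $\mathbf q\in\mathbb R^m$, $\mathbf Q\in\mathbb R^{m\times m}$, subject to, for all $k\in[K]$, $$\begin{bmatrix} s-y_k^0(\mathbf x)-\boldsymbol\lambda_k^\top\mathbf b-y_k(\mathbf x)^\top\boldsymbol\mu+\boldsymbol\lambda_k^\top\mathbf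 A\boldsymbol\mu & \frac12\left(\mathbf q+(\mathbf U\boldsymbol\Lambda^{1/2})^\top(\mathbf A^\top\boldsymbol\lambda_k-y_k(\mathbf x))\right)^\top\\ \frac12\left(\mathbf q+(\mathbf U\boldsymbol\Lambda^{1/2})^\top(\mathbf A^\top\boldsymbol\lambda_k-y_k(\mathbf x))\right)&\mathbf Q\end{bmatrix}\succeq0 .$$ *)

(* Defs.v *)
From HB Require Import structures.
From mathcomp Require Import all_boot all_order all_algebra.
From mathcomp Require Import all_classical all_reals all_analysis.
Set Implicit Arguments.
Unset Strict Implicit.
Unset Printing Implicit Defensive.
Import Order.TTheory GRing.Theory Num.Theory.
Import numFieldNormedType.Exports.
Local Open Scope classical_set_scope.
Local Open Scope ring_scope.

Section LinearAlgebra.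
Variable R : realType.

Definition dot p (u v : 'cV[R]_p) : R := (u^T *m v) 0 0.

Definition qform p (M : 'M[R]_p) (v : 'cV[R]_p) : R := (v^T *m M *m v) 0 0.

(* The Euclidean norm; the library norm `|u| on matrices is the sup norm. *)
Definition norm2 p (u : 'cV[R]_p) : R := Num.sqrt (\sum_i u i 0 ^+ 2).

(* Semidefiniteness and definiteness include symmetry. *)
Definition psd p (M : 'M[R]_p) : Prop :=
  M^T = M /\ forall v, 0 <= qform M v.

Definition posdef p (M : 'M[R]_p) : Prop :=
  M^T = M /\ forall v, v != 0 -> 0 < qform M v.

Definition frob p q (A B : 'M[R]_(p, q)) : R := \sum_i \sum_j A i j * B i j.

Definition affine (V W : lmodType R) (h : V -> W) : Prop :=
  exists (L : {linear V -> W}) (c : W), forall x, h x = L x + c.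

Definition orthonormal_cols p q (B : 'M[R]_(p, q)) : Prop := B^T *m B = 1%:M.

Definition nonneg_vec p (u : 'cV[R]_p) : Prop := forall i, 0 <= u i 0.

(* The symmetric matrix [a, u^T / 2; u / 2, Q]. *)
Definition bordered p (a : R) (u : 'cV[R]_p) (Q : 'M[R]_p) : 'M[R]_(1 + p) :=
  block_mx a%:M (2^-1 *: u^T) (2^-1 *: u) Q.

End LinearAlgebra.

Section Problems.
Variables (R : realType) (m n l K : nat).

Definition support_set (A : 'M[R]_(l, m)) (b : 'cV[R]_l) : set 'cV[R]_m :=
  [set xi | forall i, (A *m xi) i 0 <= b i 0].

Variables (gamma1 gamma2 : R) (mu : 'cV[R]_m).
(* lam is the diagonal of Lambda in Sigma = U Lambda U^T. *)
Variables (U : 'M[R]_m) (lam : 'rV[R]_m).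
Variables (X : set 'cV[R]_n) (A : 'M[R]_(l, m)) (b : 'cV[R]_l).
Variables (y0 : 'I_K -> 'cV[R]_n -> R) (y : 'I_K -> 'cV[R]_n -> 'cV[R]_m).

(* The maximum over k; a sup over a nonempty finite set as soon as 0 < K. *)
Definition pwl_cost (x : 'cV[R]_n) (xi : 'cV[R]_m) : R :=
  sup (range (fun k => y0 k x + dot (y k x) xi)).

Definition ULhalf : 'M[R]_m := U *m diag_mx (map_mx Num.sqrt lam).

Definition SI : set 'cV[R]_m := [set xi | support_set A b (ULhalf *m xi + mu)].

(* Upper-left entry of the k-th linear matrix inequality. *)
Definition corner (x : 'cV[R]_n) (s : R) (lk : 'cV[R]_l) (k : 'I_K) : R :=
  s - y0 k x - dot lk b - dot (y k x) mu + dot lk (A *m mu).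

Definition shifted_slope (x : 'cV[R]_n) (q : 'cV[R]_m) (lk : 'cV[R]_l)
    (k : 'I_K) : 'cV[R]_m :=
  q + ULhalf^T *m (A^T *m lk - y k x).

Definition objective p (s : R) (q : 'cV[R]_m) (Q : 'M[R]_p) : R :=
  s + gamma2 * frob 1%:M Q + Num.sqrt gamma1 * norm2 q.

Definition SDP_feasible (x : 'cV[R]_n) (s : R) (lambda : 'I_K -> 'cV[R]_l)
    (q : 'cV[R]_m) (Q : 'M[R]_m) : Prop :=
  X x /\
  forall k, nonneg_vec (lambda k) /\
    psd (bordered (corner x s (lambda k) k) (shifted_slope x q (lambda k) k) Q).

Definition Theta_M : \bar R :=
  ereal_inf [set z | exists x s lambda q (Q : 'M[R]_m),
    SDP_feasible x s lambda q Q /\ z = (objective s q Q)%:E].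

(* [B1, B2] has m1 + (K - m1) columns, that is K when m1 <= K; for m1 = K the
   block B2 and everything indexed by its columns is empty. *)
Section Split.
Variable m1 : nat.

(* Dual constraints of the worst-case problem, for fixed x, B1 and B2,
     maximize E[pwl_cost x (ULhalf xi + mu)]
   over the laws of xi supported in SI such that
     E[xi]^T E[xi] <= gamma1,
     E[B1^T xi xi^T B1] <= gamma2 I  and  E[B2^T xi xi^T B2] <= 0.
   The multipliers are s for the total mass, q for the mean constraint, and Q1
   and Q2 for the two second-moment constraints; Q2 has cost 0 because its
   right-hand side is 0. *)
Definition inner_dual_feasible (x : 'cV[R]_n)
    (B1 : 'M[R]_(m, m1)) (B2 : 'M[R]_(m, K - m1)) (s : R) (q : 'cV[R]_m)
    (Q1 : 'M[R]_m1) (Q2 : 'M[R]_(K - m1)) : Prop :=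
  [/\ psd Q1, psd Q2 &
      forall xi, SI xi ->
        pwl_cost x (ULhalf *m xi + mu) - qform (B1 *m Q1 *m B1^T) xi
          - qform (B2 *m Q2 *m B2^T) xi - dot q xi <= s].

(* Joint minimum over B1, B2, x and the dual variables, obtained from
   min_B min_x max_P by dualizing the inner maximum. *)
Definition dualized_value : \bar R :=
  ereal_inf [set z | exists (B1 : 'M[R]_(m, m1)) (B2 : 'M[R]_(m, K - m1))
      x s q Q1 Q2,
    [/\ orthonormal_cols (row_mx B1 B2), X x,
        inner_dual_feasible x B1 B2 s q Q1 Q2 &
        z = (objective s q Q1)%:E]].

Definition L2_feasible (x : 'cV[R]_n) (s : R) (q : 'cV[R]_m) (Q1 : 'M[R]_m1)
    (lambda : 'I_K -> 'cV[R]_l) (u1 : 'I_K -> 'cV[R]_m1)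
    (u2 : 'I_K -> 'cV[R]_(K - m1))
    (B1 : 'M[R]_(m, m1)) (B2 : 'M[R]_(m, K - m1)) : Prop :=
  [/\ X x, orthonormal_cols (row_mx B1 B2) &
      forall k,
        [/\ nonneg_vec (lambda k),
            psd (bordered (corner x s (lambda k) k) (u1 k) Q1) &
            shifted_slope x q (lambda k) k = B1 *m u1 k + B2 *m u2 k]].

Definition Theta_L2 : \bar R :=
  ereal_inf [set z | exists x s q Q1 lambda u1 u2 B1 B2,
    L2_feasible x s q Q1 lambda u1 u2 B1 B2 /\ z = (objective s q Q1)%:E].

End Split.
End Problems.

(* Main.v *)
Require Import Defs.
From HB Require Import structures.
From mathcomp Require Import all_boot all_order all_algebra.
From mathcomp Require Import all_classical all_reals all_analysis.
From mathcomp Require Import ring lra.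
Set Implicit Arguments.
Unset Strict Implicit.
Unset Printing Implicit Defensive.
Import Order.TTheory GRing.Theory Num.Theory.
Import numFieldNormedType.Exports.
Local Open Scope classical_set_scope.
Local Open Scope ring_scope.

(** Write L for U Lambda^(1/2).  All the problems share the objective and the
    vectors w_k = q + L^T (A^T lambda_k - y_k(x)), and everything rests on
    reading a linear matrix inequality [a, w^T/2; w/2, M] >= 0 as the pair
    M >= 0 and a + w . v + v^T M v >= 0 for all v ([psd_borderedP]).

    Dual versus SDP.  For fixed x, B and dual variables, the semi-infinite dual
    constraint says, for each affine piece k, that a convex quadratic in xi is
    nonnegative on the polyhedron S_I.  Since S_I has a point satisfying Slater's
    condition, Lagrange multipliers lambda_k move the linear inequalities into
    the quadratic, which is then nonnegative everywhere; so the constraint is the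
    linear matrix inequality with M = B1 Q' B1^T + B2 Q'' B2^T
    ([worst_case_lmiP]).  A quadratic bounded below has no linear part along the
    kernel of M, so w_k lies in the range of [B1, B2], and restricting xi to the
    range of B1 leaves exactly the constraints of Theta_L2 ([lmi_restrict]).
    Conversely, from a feasible point of Theta_L2, the free linear term u_k'' can
    be absorbed by a large Q'' = t I, which costs nothing, if s is raised by an
    arbitrarily small eps ([lmi_extend]).  Hence the infima agree although the
    feasible sets do not correspond exactly ([dualized_eq]).

    Comparisons.  Linear matrix inequalities survive the congruence by a matrix P
    ([bordered_congr]), and if P has orthonormal columns the trace, hence the
    objective, does not increase ([objective_compress]).  Compressing by the
    coordinate inclusion of R^m1 in R^m2, and moving the other columns of B1 to
    B2, gives monotonicity in m1.  For m1 = K, the K vectors w_k lie in the range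
    of a suitable orthonormal m x K matrix B (Gram-Schmidt,
    [orthonormal_basis_containing]); compressing by B turns a feasible point of
    (SDP) into one of Theta_L2(K), and the congruence by B^T, which preserves the
    trace, goes back.  The bound by Theta_M for general m1 combines the two. *)

(** * Lagrange multipliers for a convex function under affine constraints *)

Section Lagrange.
Variables (R : realType) (V : lmodType R).

Definition on_segment (x z : V) (t : R) : V := (1 - t) *: x + t *: z.

Definition convex_set (D : set V) : Prop :=
  forall x z t, 0 <= t <= 1 -> D x -> D z -> D (on_segment x z t).

Definition convex_fun (g : V -> R) : Prop :=
  forall x z t, 0 <= t <= 1 ->
    g (on_segment x z t) <= (1 - t) * g x + t * g z.

Definition affine_fun (h : V -> R) : Prop :=
  forall x z t, h (on_segment x z t) = (1 - t) * h x + t * h z.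

(** Slater's condition in the weak form suited to affine constraints: a constraint
    need not be strict at the point if it holds everywhere, as happens for a zero
    linear part with a zero bound. *)
Definition slater_point (l : nat) (h : 'I_l -> V -> R) (x0 : V) : Prop :=
  (forall i, h i x0 <= 0) /\
  forall i, h i x0 < 0 \/ forall x, h i x <= 0.

(** The multiplier c must satisfy c <= g z / - h z wherever h z < 0 and
    c >= - g x / h x wherever h x > 0.  Every such lower bound is below every such
    upper bound, because g >= 0 at the point of the segment from x to z where h
    vanishes; so the infimum of the upper bounds works. *)
Lemma lagrange_one_constraint (D : set V) (g h : V -> R) (x0 : V) :
    convex_set D -> convex_fun g -> affine_fun h ->
    D x0 -> h x0 < 0 ->
    (forall x, D x -> h x <= 0 -> 0 <= g x) ->
  exists2 c, 0 <= c & forall x, D x -> 0 <= g x + c * h x.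
Proof.
move=> Dconv gconv haff Dx0 hx0 gpos.
pose E := [set r | exists z, [/\ D z, h z < 0 & r = g z / - h z]].
have E0 : E !=set0 by exists (g x0 / - h x0), x0.
have Elb0 : lbound E 0.
  move=> _ [z [Dz hz ->]]; rewrite divr_ge0 ?oppr_ge0 ?(ltW hz) //.
  by rewrite gpos // ltW.
exists (inf E); first exact: lb_le_inf.
move=> x Dx; have [hx|hx|hx] := ltgtP (h x) 0.
- have : inf E <= g x / - h x by apply: ge_inf; [exists 0 | exists x].
  rewrite ler_pdivlMr ?oppr_gt0 // => ?; lra.
- have : - g x / h x <= inf E.
    apply: lb_le_inf => // _ [z [Dz hz ->]].
    rewrite ler_pdivrMr // mulrAC ler_pdivlMr ?oppr_gt0 //.
    (* the parameter at which the segment from x to z meets h = 0 *)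
    pose t := h x / (h x - h z).
    have d0 : 0 < h x - h z by lra.
    have t01 : 0 <= t <= 1.
      rewrite divr_ge0 ?(ltW hx) ?(ltW d0) //= ler_pdivrMr //; lra.
    have ht : h (on_segment x z t) = 0.
      by rewrite haff /t; field; rewrite gt_eqF.
    have gt : 0 <= g (on_segment x z t).
      by apply: gpos; [exact: Dconv | rewrite ht].
    have := le_trans gt (gconv x z t t01).
    have -> : (1 - t) * g x + t * g z
            = (h x * g z - h z * g x) / (h x - h z).
      by rewrite /t; field; rewrite gt_eqF.
    rewrite pmulr_lge0 ?invr_gt0 // => ?; lra.
  rewrite ler_pdivrMr // => ?; lra.
- by rewrite hx mulr0 addr0 gpos // hx.
Qed.

(** The constraints are moved into the objective one at a time: with a multiplier d
    for the first constraint found on the convex set where the others hold,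
    g + d h_i is again convex and the induction continues.  This avoids any
    separation theorem. *)
Lemma lagrange (l : nat) (g : V -> R) (h : 'I_l -> V -> R) (x0 : V) :
    convex_fun g -> (forall i, affine_fun (h i)) -> slater_point h x0 ->
    (forall x, (forall i, h i x <= 0) -> 0 <= g x) ->
  exists2 c : 'I_l -> R, (forall i, 0 <= c i) &
    forall x, 0 <= g x + \sum_i c i * h i x.
Proof.
move=> gconv haff [hx0 slater] gpos.
have {}gpos : forall x, (forall i, i \in enum 'I_l -> h i x <= 0) -> 0 <= g x.
  by move=> x hx; apply: gpos => i; apply: hx; rewrite mem_enum.
elim: (enum 'I_l) g gconv gpos => [|i s IH] g gconv gpos.
  exists (fun=> 0) => // x; rewrite big1 ?addr0 => [|i _]; last exact: mul0r.
  exact: gpos.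
pose D : set V := [set x | forall j, j \in s -> h j x <= 0].
have Dconv : convex_set D.
  move=> x z t /andP[t0 t1] Dx Dz j js; rewrite haff.
  by have := Dx j js; have := Dz j js => ? ?; nra.
have [d d0 gd] : exists2 d, 0 <= d & forall x, D x -> 0 <= g x + d * h i x.
  have [hi|hi] := slater i.
    apply: (lagrange_one_constraint Dconv gconv (haff i)) hi _ => [j _|x Dx hix].
      exact: hx0.
    by apply: gpos => j; rewrite inE => /orP[/eqP->//|]; exact: Dx.
  exists 0 => // x Dx; rewrite mul0r addr0.
  by apply: gpos => j; rewrite inE => /orP[/eqP->//|]; exact: Dx.
have [|//|c c0 gc] := IH (fun x => g x + d * h i x).
  move=> x z t t01; have := gconv x z t t01; rewrite haff => ?; lra.
(* d is added to c i, which may be nonzero: i can occur again in s *)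
exists (fun j => c j + d *+ (j == i)) => [j|x].
  by rewrite addr_ge0 // mulrn_wge0.
have -> : \sum_j (c j + d *+ (j == i)) * h j x
        = d * h i x + \sum_j c j * h j x.
  rewrite (eq_bigr (fun j => c j * h j x + (d * h j x) *+ (j == i))); last first.
    by move=> j _; rewrite mulrDl mulrnAl.
  rewrite big_split /= addrC; congr (_ + _).
  by rewrite (bigD1 i) //= eqxx big1 ?addr0 // => j /negPf->.
by rewrite addrA.
Qed.
End Lagrange.

(** * Quadratic forms and bordered matrices *)

Section MatrixForms.
Variable R : realType.

Lemma dotC p (u v : 'cV[R]_p) : dot u v = dot v u.
Proof. by rewrite /dot !mxE; apply: eq_bigr => i _; rewrite !mxE mulrC. Qed.

Lemma dotE p (u v : 'cV[R]_p) : dot u v = \sum_i u i 0 * v i 0.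
Proof. by rewrite /dot !mxE; apply: eq_bigr => i _; rewrite !mxE. Qed.

Lemma dotDr p (u v w : 'cV[R]_p) : dot u (v + w) = dot u v + dot u w.
Proof. by rewrite /dot mulmxDr mxE. Qed.

Lemma dotDl p (u v w : 'cV[R]_p) : dot (v + w) u = dot v u + dot w u.
Proof. by rewrite dotC dotDr !(dotC u). Qed.

Lemma dotZr p a (u v : 'cV[R]_p) : dot u (a *: v) = a * dot u v.
Proof. by rewrite /dot -scalemxAr mxE. Qed.

Lemma dotZl p a (u v : 'cV[R]_p) : dot (a *: u) v = a * dot u v.
Proof. by rewrite dotC dotZr dotC. Qed.

Lemma dot_adj p q (M : 'M[R]_(p, q)) u v : dot (M *m u) v = dot u (M^T *m v).
Proof. by rewrite /dot trmx_mul mulmxA. Qed.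

Lemma dot_ge0 p (u : 'cV[R]_p) : 0 <= dot u u.
Proof. by rewrite dotE sumr_ge0 // => i _; rewrite -expr2 sqr_ge0. Qed.

Lemma dot_eq0 p (u : 'cV[R]_p) : dot u u = 0 -> u = 0.
Proof.
rewrite dotE => /psumr_eq0P u0; apply/matrixP=> i j; rewrite ord1 mxE.
by apply/eqP; rewrite -sqrf_eq0 expr2 u0 // => k _; rewrite -expr2 sqr_ge0.
Qed.

Lemma qformE p (M : 'M[R]_p) v : qform M v = dot v (M *m v).
Proof. by rewrite /qform /dot mulmxA. Qed.

Lemma qform_congr p q (M : 'M[R]_p) (P : 'M[R]_(p, q)) v :
  qform (P^T *m M *m P) v = qform M (P *m v).
Proof. by rewrite !qformE dot_adj !mulmxA. Qed.

Lemma qform_congrT p q (M : 'M[R]_p) (P : 'M[R]_(q, p)) v :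
  qform (P *m M *m P^T) v = qform M (P^T *m v).
Proof. by rewrite -qform_congr trmxK. Qed.

Lemma qformDl p (M N : 'M[R]_p) v : qform (M + N) v = qform M v + qform N v.
Proof. by rewrite !qformE mulmxDl dotDr. Qed.

Lemma qformZr p (M : 'M[R]_p) a v : qform M (a *: v) = a ^+ 2 * qform M v.
Proof. by rewrite !qformE -scalemxAr dotZr dotZl mulrA. Qed.

Lemma qform_scalar p (a : R) (v : 'cV[R]_p) : qform a%:M v = a * dot v v.
Proof. by rewrite qformE mul_scalar_mx dotZr. Qed.

Lemma psd_congr p q (M : 'M[R]_p) (P : 'M[R]_(p, q)) :
  psd M -> psd (P^T *m M *m P).
Proof.
move=> [sM M0]; split; first by rewrite !trmx_mul trmxK sM mulmxA.
by move=> v; rewrite qform_congr.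
Qed.

Lemma psd_congrT p q (M : 'M[R]_p) (P : 'M[R]_(q, p)) :
  psd M -> psd (P *m M *m P^T).
Proof. by move=> /(psd_congr P^T); rewrite trmxK. Qed.

Lemma psdD p (M N : 'M[R]_p) : psd M -> psd N -> psd (M + N).
Proof.
move=> [sM M0] [sN N0]; split; first by rewrite linearD /= sM sN.
by move=> v; rewrite qformDl addr_ge0.
Qed.

Lemma psd_scalar p (a : R) : 0 <= a -> psd (a%:M : 'M[R]_p).
Proof.
move=> a0; split=> [|v]; first exact: tr_scalar_mx.
by rewrite qform_scalar mulr_ge0 ?dot_ge0.
Qed.

Lemma dot_col_mx p q (u1 v1 : 'cV[R]_p) (u2 v2 : 'cV[R]_q) :
  dot (col_mx u1 u2) (col_mx v1 v2) = dot u1 v1 + dot u2 v2.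
Proof. by rewrite /dot tr_col_mx mul_row_col mxE. Qed.

Lemma dot_scalar t (v : 'cV[R]_1) : dot t%:M v = t * v 0 0.
Proof. by rewrite /dot tr_scalar_mx mul_scalar_mx mxE. Qed.

Lemma qform_bordered p (a : R) (u : 'cV[R]_p) (Q : 'M[R]_p) t v :
  qform (bordered a u Q) (col_mx t%:M v) = a * t ^+ 2 + t * dot u v + qform Q v.
Proof.
rewrite !qformE /bordered mul_block_col dot_col_mx dot_scalar.
rewrite -scalar_mxM -!scalemxAl mul_mx_scalar dotDr !dotZr (dotC v u).
have -> : ((a * t)%:M + 2^-1 *: (u^T *m v)) 0 0 = a * t + 2^-1 * dot u v.
  by rewrite 3!mxE mulr1n.
by field.
Qed.

(** The quadratic form of the bordered matrix at (t, v) is t^2 times the quadratic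
    function at v / t; the case t = 0 is the semidefiniteness of Q. *)
Lemma psd_borderedP p (a : R) (u : 'cV[R]_p) (Q : 'M[R]_p) :
  psd (bordered a u Q) <-> psd Q /\ forall v, 0 <= a + dot u v + qform Q v.
Proof.
split=> [[sB B0]|[[sQ Q0] aff]].
  split; first split.
  - by have := sB; rewrite /bordered tr_block_mx => /eq_block_mx[].
  - move=> v; have := B0 (col_mx 0%:M v); rewrite qform_bordered.
    by rewrite expr0n mulr0 mul0r !add0r.
  - move=> v; have := B0 (col_mx 1%:M v); rewrite qform_bordered.
    by rewrite expr1n mulr1 mul1r.
split.
  by rewrite /bordered tr_block_mx !linearZ /= trmxK tr_scalar_mx sQ.
move=> w; rewrite -(vsubmxK w) [usubmx w]mx11_scalar qform_bordered.
set t := usubmx w 0 0; set v := dsubmx w.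
have [->|t0] := eqVneq t 0; first by rewrite expr0n mulr0 mul0r !add0r.
have := mulr_ge0 (sqr_ge0 t) (aff (t^-1 *: v)).
rewrite dotZr qformZr; congr (0 <= _); by field.
Qed.

Lemma bordered_congr p q a u Q (P : 'M[R]_(p, q)) :
  psd (bordered a u Q) -> psd (bordered a (P^T *m u) (P^T *m Q *m P)).
Proof.
move=> /psd_borderedP[Q0 aff]; apply/psd_borderedP; split.
  exact: psd_congr.
by move=> v; rewrite qform_congr dot_adj trmxK; exact: aff.
Qed.

Lemma frob1 p (Q : 'M[R]_p) : frob 1%:M Q = \tr Q.
Proof.
apply: eq_bigr => i _; rewrite (bigD1 i) //= mxE eqxx mul1r big1 ?addr0 //.
by move=> j ji; rewrite mxE eq_sym (negPf ji) mul0r.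
Qed.

Lemma psd_trace_ge0 p (Q : 'M[R]_p) : psd Q -> 0 <= \tr Q.
Proof.
move=> [_ Q0]; apply: sumr_ge0 => i _; have := Q0 (delta_mx i 0).
by rewrite /qform trmx_delta -rowE -colE !mxE.
Qed.

(** With C = I - P P^T an orthogonal projection, the difference of the two sides is
    tr (C^T Q C), which is nonnegative. *)
Lemma trace_compression_le p q (Q : 'M[R]_p) (P : 'M[R]_(p, q)) :
  psd Q -> orthonormal_cols P -> \tr (P^T *m Q *m P) <= \tr Q.
Proof.
rewrite /orthonormal_cols => Q0 PP; pose C := 1%:M - P *m P^T.
have CC : C *m C^T = C.
  rewrite /C linearB /= tr_scalar_mx trmx_mul trmxK mulmxBl mul1mx mulmxBr.
  by rewrite mulmx1 -mulmxA [P^T *m (_ *m _)]mulmxA PP mul1mx subrr subr0.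
have := psd_trace_ge0 (psd_congr C Q0).
rewrite mxtrace_mulC mulmxA CC /C mulmxBl mul1mx linearB /= subr_ge0.
by rewrite -(mulmxA P) (mxtrace_mulC P).
Qed.

(** The convexity gap is (1 - t) t times the quadratic form at x - z. *)
Lemma quadratic_convex p (a : R) (w : 'cV[R]_p) (M : 'M[R]_p) :
  psd M -> convex_fun (fun v : 'cV[R]_p => a + dot w v + qform M v).
Proof.
move=> [sM M0] x z t /andP[t0 t1].
have := M0 (x + (-1) *: z).
rewrite /on_segment !qformE !mulmxDr -!scalemxAr.
rewrite !(dotDr, dotDl, dotZr, dotZl).
move: (dot x (M *m x)) (dot x (M *m z)) (dot z (M *m x)) (dot z (M *m z)).
move: (dot w x) (dot w z) => wx wz xx xz zx zz h.
have : 0 <= (1 - t) * t * (xx + -1 * xz + (-1 * zx + -1 * (-1 * zz))).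
  by rewrite !mulr_ge0 ?subr_ge0 //; lra.
by move=> ?; lra.
Qed.

(** * Orthonormal columns *)

Lemma orthonormal_row_mxP m p q (B : 'M[R]_(m, p)) (C : 'M[R]_(m, q)) :
  orthonormal_cols (row_mx B C) <->
  [/\ orthonormal_cols B, orthonormal_cols C & C^T *m B = 0].
Proof.
rewrite /orthonormal_cols tr_row_mx mul_col_row scalar_mx_block; split.
  by move=> /eq_block_mx[].
move=> [-> -> CB]; rewrite CB -(trmxK (B^T *m C)) trmx_mul trmxK CB.
by rewrite linear0.
Qed.

(** A Gram-Schmidt step that never fails: when w already lies in the range of B,
    any unit vector orthogonal to B serves, and one exists because B has fewer
    columns than rows. *)
Lemma orthonormal_extension m j (B : 'M[R]_(m, j)) (w : 'cV[R]_m) :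
    (j < m)%N -> orthonormal_cols B ->
  exists c : 'cV[R]_m, [/\ dot c c = 1, B^T *m c = 0 &
    w = c *m (c^T *m w) + B *m (B^T *m w)].
Proof.
move=> jm oB; pose r := w - B *m (B^T *m w).
have Br : B^T *m r = 0.
  by rewrite mulmxBr !mulmxA oB mul1mx subrr.
have [c0 [c0n0 Bc0 wc0]] : exists c : 'cV[R]_m,
    [/\ c != 0, B^T *m c = 0 & exists a, r = a *: c].
  have [r0|rn0] := eqVneq r 0; last first.
    by exists r; split=> //; exists 1; rewrite scale1r.
  have : kermx B != 0.
    by rewrite kermx_eq0 /row_free ltn_eqF // (leq_ltn_trans (rank_leq_col _)).
  move=> /rowV0Pn[v /sub_kermxP vB v0]; exists v^T; split.
  - by rewrite trmx_eq0.
  - by rewrite -trmx_mul vB linear0.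
  - by exists 0; rewrite scale0r r0.
have d0 : 0 < dot c0 c0.
  by rewrite lt_def dot_ge0 andbT; apply: contra_neq c0n0; exact: dot_eq0.
pose a := (Num.sqrt (dot c0 c0))^-1; pose c := a *: c0.
have a0 : a != 0 by rewrite invr_eq0 gt_eqF // sqrtr_gt0.
have cc : dot c c = 1.
  rewrite /c dotZl dotZr mulrA -expr2 exprVn sqr_sqrtr ?mulVf ?gt_eqF //.
  exact: ltW.
have Bc : B^T *m c = 0 by rewrite -scalemxAr Bc0 scaler0.
exists c; split=> //.
have [e re] : exists e, r = e *: c.
  by have [e ->] := wc0; exists (e / a); rewrite scalerA divfK.
have w_eq : w = e *: c + B *m (B^T *m w) by rewrite -re /r subrK.
have -> : c^T *m w = e%:M.
  rewrite [c^T *m w]mx11_scalar -/(dot c w) w_eq dotDr dotZr cc mulr1.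
  rewrite [dot c (B *m _)]dotC dot_adj Bc.
  by rewrite [dot _ 0]/dot mulmx0 mxE addr0.
by rewrite mul_mx_scalar.
Qed.

Lemma orthonormal_basis_containing m j (W : 'M[R]_(m, j)) : (j <= m)%N ->
  exists2 B : 'M[R]_(m, j), orthonormal_cols B & B *m (B^T *m W) = W.
Proof.
elim: j W => [|j IH]; last rewrite -[j.+1]/(1 + j)%N; move=> W jm.
  by exists 0; [apply/matrixP => -[] | apply/matrixP => i []].
rewrite -(hsubmxK W).
have [B oB BW] := IH (rsubmx W) (ltnW jm).
have [c [cc Bc wc]] := orthonormal_extension (lsubmx W) jm oB.
exists (row_mx c B).
  apply/orthonormal_row_mxP; split=> //.
  by rewrite /orthonormal_cols [c^T *m c]mx11_scalar -/(dot c c) cc.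
rewrite tr_row_mx mul_col_mx mul_row_col !mul_mx_row add_row_mx.
have cB : c *m (c^T *m rsubmx W) = 0.
  by rewrite -BW !mulmxA -(mulmxA c) -(trmxK (c^T *m B)) trmx_mul trmxK Bc
             linear0 mulmx0 !mul0mx.
by rewrite -wc cB BW add0r.
Qed.

End MatrixForms.

(** * Semi-infinite constraints as linear matrix inequalities *)

Section Reformulation.
Variables (R : realType) (m n l K : nat).
Variables (gamma1 gamma2 : R) (mu : 'cV[R]_m) (U : 'M[R]_m) (lam : 'rV[R]_m).
Variables (X : set 'cV[R]_n) (A : 'M[R]_(l, m)) (b : 'cV[R]_l).
Variables (y0 : 'I_K -> 'cV[R]_n -> R) (y : 'I_K -> 'cV[R]_n -> 'cV[R]_m).

Local Notation L := (ULhalf U lam).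
Local Notation corner := (corner mu A b y0 y).
Local Notation slope := (shifted_slope U lam A y).

Definition excess (i : 'I_l) (xi : 'cV[R]_m) : R :=
  (A *m (L *m xi + mu)) i 0 - b i 0.

Lemma excess_affine i : affine_fun (excess i).
Proof.
move=> x z t; rewrite /excess /on_segment.
have -> : L *m ((1 - t) *: x + t *: z) + mu
        = (1 - t) *: (L *m x + mu) + t *: (L *m z + mu).
  rewrite mulmxDr -!scalemxAr !scalerDr addrACA -[in LHS](scale1r mu).
  by rewrite -scalerDl subrK.
rewrite (mulmxDr A (_ *: _)) -!scalemxAr.
move: (A *m (L *m x + mu)) (A *m (L *m z + mu)) => u v.
by rewrite !mxE; ring.
Qed.

Lemma pwl_cost_leP x xi r : (0 < K)%N ->
  pwl_cost y0 y x xi <= r <-> forall k, y0 k x + dot (y k x) xi <= r.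
Proof.
move=> K0; rewrite /pwl_cost; set f := fun k => _; split=> [fr k|fr].
  apply: le_trans fr; apply: ub_le_sup; last by exists k.
  exists (\sum_j `|f j|) => _ [j _ <-]; rewrite (le_trans (ler_norm _)) //.
  by rewrite (bigD1 j) //= lerDl sumr_ge0.
apply: ge_sup => [|_ [k _ <-]]; last exact: fr.
by exists (f (Ordinal K0)), (Ordinal K0).
Qed.

Lemma lagrangianE x s q lk k xi :
  corner x s lk k + dot (slope x q lk k) xi =
  s - y0 k x - dot (y k x) (L *m xi + mu) + dot q xi
    + \sum_i lk i 0 * excess i xi.
Proof.
have -> : \sum_i lk i 0 * excess i xi
        = dot lk (A *m (L *m xi)) + dot lk (A *m mu) - dot lk b.
  rewrite -dotDr -mulmxDr !dotE -sumrB; apply: eq_bigr => i _.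
  by rewrite mulrBr.
rewrite /Defs.corner /shifted_slope dotDl dot_adj trmxK dotDl !dotDr.
rewrite -[in - y k x]scaleN1r dotZl dot_adj trmxK; ring.
Qed.

Lemma ULhalf_surj (Sigma : 'M[R]_m) :
    posdef Sigma -> U^T *m U = 1%:M -> Sigma = U *m diag_mx lam *m U^T ->
  forall z : 'cV[R]_m, exists xi, L *m xi = z.
Proof.
move=> [_ Spos] UU SE z.
have lam0 i : 0 < lam 0 i.
  have /Spos : U *m (delta_mx i 0 : 'cV[R]_m) != 0.
    apply/eqP => /(congr1 (fun v : 'cV_m => U^T *m v)).
    rewrite mulmxA UU mul1mx mulmx0 => /matrixP/(_ i 0).
    by rewrite !mxE !eqxx => /eqP; rewrite oner_eq0.
  rewrite SE qform_congrT mulmxA UU mul1mx qformE -colE dotE.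
  rewrite (bigD1 i) //= big1 => [|j /negPf ji]; last first.
    by rewrite !mxE ji mul0r.
  by rewrite !mxE !eqxx mulr1n mul1r addr0.
exists (diag_mx (map_mx (fun r => (Num.sqrt r)^-1) lam) *m (U^T *m z)).
rewrite /ULhalf !mulmxA -(mulmxA U) mulmx_diag.
have -> : \row_j (map_mx Num.sqrt lam 0 j *
    map_mx (fun r => (Num.sqrt r)^-1) lam 0 j) = const_mx 1.
  by apply/rowP=> j; rewrite !mxE mulfV // gt_eqF // sqrtr_gt0.
by rewrite diag_const_mx mulmx1 (mulmx1C UU) mul1mx.
Qed.

(** Were a constraint tight at the preimage xi0 of an interior point but violated
    at some xi, it would also be violated on the way from xi0 to xi, arbitrarily
    close to xi0, where the image is still in the support set. *)
Lemma slater_point_exists :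
    interior (support_set A b) !=set0 ->
    (forall z : 'cV[R]_m, exists xi, L *m xi = z) ->
  exists xi0, slater_point excess xi0.
Proof.
move=> [z0 /nbhs_ballP[e /= e0 ze]] Lsurj.
have [xi0 Lxi0] := Lsurj (z0 - mu).
have Lz0 : L *m xi0 + mu = z0 by rewrite Lxi0 subrK.
have le0 i : excess i xi0 <= 0.
  by rewrite subr_le0 Lz0; apply: ze; exact: ballxx.
exists xi0; split=> // i; have [si|si] := ltP (excess i xi0) 0; first by left.
right=> xi; rewrite leNgt; apply/negP => sxi.
have [d dE] : exists d : 'cV[R]_m, L *m (xi - xi0) = d by eexists.
(* a step e / N in the direction d stays in the sup-norm ball of radius e *)
pose N := 1 + \sum_j `|d j 0|.
have N0 : 0 < N by rewrite ltr_pwDl // sumr_ge0.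
have dN j : `|d j 0| < N.
  by rewrite /N (bigD1 j) //= addrCA ltrDl ltr_pwDl // sumr_ge0.
pose t := e / N.
have t0 : 0 < t by rewrite divr_gt0.
have : support_set A b (L *m on_segment xi0 xi t + mu).
  have -> : L *m on_segment xi0 xi t + mu = z0 + t *: d.
    have -> : on_segment xi0 xi t = xi0 + t *: (xi - xi0).
      by rewrite /on_segment scalerBl scale1r scalerBr -addrA [- _ + _]addrC.
    by rewrite mulmxDr -scalemxAr dE addrAC Lz0.
  apply: ze; split=> // j k; rewrite ord1 /ball /= !mxE opprD addrA subrr sub0r.
  by rewrite normrN normrM gtr0_norm // /t mulrAC ltr_pdivrMr // ltr_pM2l.
move=> /(_ i); rewrite -subr_le0 -/(excess i _) excess_affine.
have -> : excess i xi0 = 0 by apply/eqP; rewrite eq_le le0 si.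
by rewrite mulr0 add0r leNgt mulr_gt0.
Qed.

(** Strong duality gives the multipliers; conversely, on S_I the multiplier terms
    are nonpositive and can be dropped. *)
Lemma worst_case_lmiP (M : 'M[R]_m) x s q k (xi0 : 'cV[R]_m) :
    slater_point excess xi0 -> psd M ->
  (forall xi, SI mu U lam A b xi ->
     y0 k x + dot (y k x) (L *m xi + mu) - qform M xi - dot q xi <= s) <->
  (exists lk, nonneg_vec lk /\
     psd (bordered (corner x s lk k) (slope x q lk k) M)).
Proof.
move=> slater M0; pose a := s - y0 k x - dot (y k x) mu.
pose w := q - L^T *m y k x.
have gE xi : a + dot w xi + qform M xi =
    s - (y0 k x + dot (y k x) (L *m xi + mu) - qform M xi - dot q xi).
  rewrite /a /w dotDl dotDr -[in - (L^T *m _)]scaleN1r dotZl dot_adj trmxK.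
  ring.
have SIE xi : SI mu U lam A b xi <-> forall i, excess i xi <= 0.
  by split=> xiS i; have := xiS i; rewrite /excess subr_le0.
have lmiE lk xi : corner x s lk k + dot (slope x q lk k) xi + qform M xi =
    a + dot w xi + qform M xi + \sum_i lk i 0 * excess i xi.
  rewrite lagrangianE gE; ring.
split=> [wc|[lk [lk0 /psd_borderedP[_ aff]]] xi /SIE xiS].
  have [|c c0 gc] := lagrange (quadratic_convex a w M0) excess_affine slater.
    by move=> xi /SIE xiS; rewrite gE subr_ge0; exact: wc.
  exists (\col_i c i); split=> [i|]; first by rewrite mxE.
  apply/psd_borderedP; split=> // xi; rewrite lmiE.
  by under eq_bigr do rewrite mxE; exact: gc.
rewrite -subr_ge0 -gE (le_trans (aff xi)) // lmiE gerDl.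
by apply: sumr_le0 => i _; rewrite mulr_ge0_le0.
Qed.

(** On the line through c the quadratic function is affine and nonnegative, hence
    constant. *)
Lemma bordered_kernel p (a : R) (w c : 'cV[R]_p) (M : 'M[R]_p) :
  psd (bordered a w M) -> qform M c = 0 -> dot w c = 0.
Proof.
move=> /psd_borderedP[_ aff] Mc; apply/eqP/negP => /negP wc.
have := aff ((- (a + 1) / dot w c) *: c).
by rewrite dotZr qformZr Mc mulr0 addr0 divfK // => ?; lra.
Qed.

Section Blocks.
Variables (p1 p2 : nat) (B1 : 'M[R]_(m, p1)) (B2 : 'M[R]_(m, p2)).
Hypothesis oB : orthonormal_cols (row_mx B1 B2).

(** The residual r of w after projection on the range of [B1, B2] is killed by the
    quadratic form, hence orthogonal to w, hence to itself. *)
Lemma lmi_restrict a (w : 'cV[R]_m) (Q1 : 'M[R]_p1) (Q2 : 'M[R]_p2) :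
    psd (bordered a w (B1 *m Q1 *m B1^T + B2 *m Q2 *m B2^T)) ->
  psd (bordered a (B1^T *m w) Q1) /\
  w = B1 *m (B1^T *m w) + B2 *m (B2^T *m w).
Proof.
move=> lmi; have [BB1 BB2 BB21] := (orthonormal_row_mxP B1 B2).1 oB.
have BB12 : B1^T *m B2 = 0.
  by rewrite -(trmxK (B1^T *m B2)) trmx_mul trmxK BB21 linear0.
split.
  have := bordered_congr B1 lmi; congr (psd (bordered _ _ _)).
  rewrite mulmxDr mulmxDl !mulmxA BB1 BB12 !mul0mx addr0 mul1mx.
  by rewrite -mulmxA BB1 mulmx1.
apply/eqP; rewrite -subr_eq0; apply/eqP; set v := B1 *m _ + _.
pose r := w - v.
have r1 : B1^T *m r = 0.
  by rewrite /r mulmxBr mulmxDr !mulmxA BB1 BB12 !mul0mx mul1mx addr0 subrr.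
have r2 : B2^T *m r = 0.
  by rewrite /r mulmxBr mulmxDr !mulmxA BB2 BB21 !mul0mx mul1mx add0r subrr.
apply: dot_eq0; rewrite -/r {1}/r dotDl -scaleN1r dotZl dotDl !dot_adj r1 r2.
rewrite (bordered_kernel lmi) ?qformDl ?qform_congrT ?r1 ?r2 ?qformE.
  by rewrite !mulmx0 /dot !mulmx0 !mxE !add0r mulr0.
by rewrite !mulmx0 /dot !mulmx0 !mxE addr0.
Qed.

(** By completing the square, t |v2|^2 + u2 . v2 + eps >= 0 for all v2 as soon as
    |u2|^2 <= 4 t eps. *)
Lemma lmi_extend a (u1 : 'cV[R]_p1) (u2 : 'cV[R]_p2) (Q1 : 'M[R]_p1) eps t :
    0 < t -> dot u2 u2 <= 4 * t * eps -> psd (bordered a u1 Q1) ->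
  psd (bordered (a + eps) (B1 *m u1 + B2 *m u2)
         (B1 *m Q1 *m B1^T + B2 *m t%:M *m B2^T)).
Proof.
move=> t0 te /psd_borderedP[Q10 aff]; apply/psd_borderedP; split.
  by apply: psdD; apply: psd_congrT => //; apply: psd_scalar; exact: ltW.
move=> v; rewrite qformDl !qform_congrT qform_scalar dotDl.
rewrite (dot_adj B1) (dot_adj B2).
move: (aff (B1^T *m v)); move: (B1^T *m v) (B2^T *m v) => v1 v2 aff1.
have : 0 <= 4 * t * (dot u2 v2 + t * dot v2 v2 + eps).
  have := dot_ge0 ((2 * t) *: v2 + u2).
  by rewrite dotDl !dotDr !dotZl !dotZr (dotC v2 u2) => ?; lra.
rewrite pmulr_rge0 ?mulr_gt0 // => ?; lra.
Qed.

End Blocks.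

Lemma corner_shift x s lk k eps :
  corner x (s + eps) lk k = corner x s lk k + eps.
Proof. rewrite /Defs.corner; ring. Qed.

Lemma objective_shift p s eps (q : 'cV[R]_m) (Q : 'M[R]_p) :
  objective gamma1 gamma2 (s + eps) q Q = objective gamma1 gamma2 s q Q + eps.
Proof. rewrite /objective; ring. Qed.

Lemma objective_compress p r s (q : 'cV[R]_m) (Q : 'M[R]_p) (P : 'M[R]_(p, r)) :
    0 <= gamma2 -> psd Q -> orthonormal_cols P ->
  objective gamma1 gamma2 s q (P^T *m Q *m P) <= objective gamma1 gamma2 s q Q.
Proof.
move=> g2 Q0 oP; rewrite /objective !frob1 lerD2r lerD2l ler_wpM2l //.
exact: trace_compression_le.
Qed.

(** * Comparison of the optimal values *)

Local Notation dualized := (dualized_value gamma1 gamma2 mu U lam X A b y0 y).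
Local Notation ThetaL2 := (Theta_L2 gamma1 gamma2 mu U lam X A b y0 y).
Local Notation ThetaM := (Theta_M gamma1 gamma2 mu U lam X A b y0 y).

(** A feasible point of the dualized problem gives one of the SDP formulation with
    the same objective.  In the other direction s is raised by eps > 0, because
    the quadratic form in the directions of B2 absorbs a nonzero u_k'' only when
    the constant term has some room left. *)
Lemma dualized_eq m1 : (0 < K)%N -> (exists xi0, slater_point excess xi0) ->
  dualized m1 = ThetaL2 m1.
Proof.
move=> K0 [xi0 slater].
have dualP x (B1 : 'M[R]_(m, m1)) (B2 : 'M[R]_(m, K - m1)) s (q : 'cV_m) Q1 Q2 :
    inner_dual_feasible mu U lam A b y0 y x B1 B2 s q Q1 Q2 <->
    [/\ psd Q1, psd Q2 & forall k, exists lk, nonneg_vec lk /\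
      psd (bordered (corner x s lk k) (slope x q lk k)
             (B1 *m Q1 *m B1^T + B2 *m Q2 *m B2^T))].
  split=> -[Q10 Q20 wc]; split=> //;
    have M0 := psdD (psd_congrT B1 Q10) (psd_congrT B2 Q20).
    move=> k; apply/(worst_case_lmiP x s q k slater M0) => xi xiS.
    have := wc xi xiS; rewrite !lerBlDr => /(pwl_cost_leP _ _ _ K0)/(_ k).
    by rewrite qformDl => ?; lra.
  move=> xi xiS; rewrite !lerBlDr; apply/(pwl_cost_leP _ _ _ K0) => k.
  have /(worst_case_lmiP x s q k slater M0)/(_ xi xiS) := wc k.
  by rewrite qformDl => ?; lra.
apply/eqP; rewrite eq_le; apply/andP; split.
  apply: le_ereal_inf_tmp.
  move=> _ [x [s [q [Q1 [lambda [u1 [u2 [B1 [B2 [feas ->]]]]]]]]]].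
  have [Xx oB lmi] := feas; apply/lee_addgt0Pr => eps eps0.
  (* one t large enough for all the pieces *)
  pose t := 1 + \sum_k dot (u2 k) (u2 k) / (4 * eps).
  have t0 : 0 < t.
    rewrite ltr_pwDl // sumr_ge0 // => k _.
    by rewrite divr_ge0 ?dot_ge0 ?mulr_ge0 ?ltW.
  have tk k : dot (u2 k) (u2 k) <= 4 * t * eps.
    rewrite mulrAC -ler_pdivrMl ?mulr_gt0 // mulrC /t (bigD1 k) //= addrCA lerDl.
    rewrite addr_ge0 // sumr_ge0 // => j _.
    by rewrite divr_ge0 ?dot_ge0 ?mulr_ge0 ?ltW.
  rewrite -EFinD -objective_shift; apply: ereal_inf_lbound.
  exists B1, B2, x, (s + eps), q, Q1, t%:M; split=> //; apply/dualP; split.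
  - by have [_ /psd_borderedP[]] := lmi (Ordinal K0).
  - by apply: psd_scalar; exact: ltW.
  - move=> k; exists (lambda k); have [lk0 lk ->] := lmi k.
    by split=> //; rewrite corner_shift; exact: lmi_extend.
apply: le_ereal_inf_tmp => _ [B1 [B2 [x [s [q [Q1 [Q2 [oB Xx feas ->]]]]]]]].
have /dualP[Q10 Q20 /choice[lambda lmi]] := feas; apply: ereal_inf_lbound.
exists x, s, q, Q1, lambda, (fun k => B1^T *m slope x q (lambda k) k),
  (fun k => B2^T *m slope x q (lambda k) k), B1, B2; split=> //; split=> // k.
have [lk0 /(lmi_restrict oB)[lk eq_slope]] := lmi k.
by split.
Qed.

(** The columns of B1 of index at least m1 join B2, and the matching components
    of u_k' join u_k''; the rest is compressed by the inclusion P of R^m1. *)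
Lemma Theta_L2_monotone m1 m2 :
    (0 < K)%N -> 0 <= gamma2 -> (m1 <= m2 <= K)%N ->
  (ThetaL2 m1 <= ThetaL2 m2)%E.
Proof.
move=> K0 g2 /andP[le12 leK].
apply: le_ereal_inf_tmp.
move=> _ [x [s [q [Q1 [lambda [u1 [u2 [B1 [B2 [feas ->]]]]]]]]]].
have {feas} [Xx oB lmi] := feas.
have Q10 : psd Q1 by have [_ /psd_borderedP[]] := lmi (Ordinal K0).
(* m2 becomes m1 + d, so that the blocks have the right types *)
have /subnKC em2 := le12; move: (m2 - m1)%N em2 => d em2; subst m2.
have eK : (K - m1 = d + (K - (m1 + d)))%N.
  by rewrite subnDA subnKC // leq_subRL // (leq_trans _ leK) ?leq_addr.
move: (K - (m1 + d))%N eK B2 u2 oB lmi => e eK B2 u2 oB lmi.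
pose P : 'M[R]_(m1 + d, m1) := col_mx 1%:M 0.
have oP : orthonormal_cols P.
  by rewrite /orthonormal_cols tr_col_mx mul_row_col trmx1 mul1mx mulmx0 addr0.
have BP : B1 *m P = lsubmx B1.
  by rewrite -{1}(hsubmxK B1) mul_row_col mulmx1 mulmx0 addr0.
have Pu k : P^T *m u1 k = usubmx (u1 k).
  rewrite -{1}(vsubmxK (u1 k)) tr_col_mx mul_row_col trmx1 trmx0 mul1mx.
  by rewrite mul0mx addr0.
have [B2' [u2' [oB' sB']]] : exists (B2' : 'M[R]_(m, K - m1)) u2',
    orthonormal_cols (row_mx (B1 *m P) B2') /\ forall k,
    B1 *m u1 k + B2 *m u2 k = B1 *m P *m (P^T *m u1 k) + B2' *m u2' k.
  rewrite {}eK; exists (row_mx (rsubmx B1) B2).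
  exists (fun k => col_mx (dsubmx (u1 k)) (u2 k)); split=> [|k]; rewrite BP.
    move: oB; rewrite -(hsubmxK B1) row_mxKl row_mxKr.
    move=> /orthonormal_row_mxP[/orthonormal_row_mxP[oa ob oba] oc ocB].
    move: ocB; rewrite mul_mx_row -row_mx0 => /eq_row_mx[oca ocb].
    apply/orthonormal_row_mxP; split=> //.
      by apply/orthonormal_row_mxP.
    by rewrite tr_row_mx mul_col_mx oba oca col_mx0.
  rewrite Pu mul_row_col addrA; congr (_ + _).
  by rewrite -{1}(hsubmxK B1) -{1}(vsubmxK (u1 k)) mul_row_col.
apply: le_trans (_ : (objective gamma1 gamma2 s q (P^T *m Q1 *m P))%:E <= _)%E.
  apply: ereal_inf_lbound; exists x, s, q, (P^T *m Q1 *m P), lambda.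
  exists (fun k => P^T *m u1 k), u2', (B1 *m P), B2'; split=> //; split=> // k.
  have [lk0 lk ->] := lmi k; split=> //; exact: bordered_congr.
by rewrite lee_fin; exact: objective_compress.
Qed.

Lemma Theta_L2_full : (0 < K <= m)%N -> 0 <= gamma2 -> ThetaL2 K = ThetaM.
Proof.
move=> /andP[K0 Km] g2.
have oE p (B : 'M[R]_(m, p)) (C : 'M[R]_(m, K - K)) :
    orthonormal_cols (row_mx B C) <-> orthonormal_cols B.
  move: (subnn K) C => -> C; split=> [/orthonormal_row_mxP[]//|oB].
  by apply/orthonormal_row_mxP; split=> //; apply/matrixP => -[].
have flat0 (u : 'cV[R]_(K - K)) : u = 0.
  by move: (subnn K) u => -> u; exact: flatmx0.
apply/eqP; rewrite eq_le; apply/andP; split.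
  apply: le_ereal_inf_tmp => _ [x [s [lambda [q [Q [[Xx lmi] ->]]]]]].
  pose W := \matrix_(i < m, k < K) slope x q (lambda k) k i 0.
  have [B oB BW] := orthonormal_basis_containing W Km.
  have Q0 : psd Q by have [_ /psd_borderedP[]] := lmi (Ordinal K0).
  have range k : slope x q (lambda k) k = B *m (B^T *m slope x q (lambda k) k).
    have -> : slope x q (lambda k) k = col k W.
      by apply/colP => i; rewrite !mxE.
    by rewrite colE mulmxA mulmxA -(mulmxA B) BW.
  apply: le_trans (_ : (objective gamma1 gamma2 s q (B^T *m Q *m B))%:E <= _)%E.
    apply: ereal_inf_lbound; exists x, s, q, (B^T *m Q *m B), lambda.
    exists (fun k => B^T *m slope x q (lambda k) k), (fun=> 0), B, 0.
    split=> //; split=> // [|k]; first exact/oE.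
    have [lk0 lk] := lmi k; split=> //; first exact: bordered_congr.
    by rewrite mulmx0 addr0.
  by rewrite lee_fin; exact: objective_compress.
apply: le_ereal_inf_tmp.
move=> _ [x [s [q [Q1 [lambda [u1 [u2 [B1 [B2 [feas ->]]]]]]]]]].
have {feas} [Xx /oE oB lmi] := feas.
apply: ereal_inf_lbound; exists x, s, lambda, q, (B1 *m Q1 *m B1^T); split.
  split=> // k; have [lk0 lk ->] := lmi k; split=> //.
  have -> : B2 *m u2 k = 0.
    by rewrite (flat0 (u2 k)) mulmx0.
  by rewrite addr0; have := bordered_congr B1^T lk; rewrite trmxK.
by rewrite /objective !frob1 mxtrace_mulC mulmxA oB mul1mx.
Qed.

End Reformulation.

Theorem theorem6 (R : realType) (m n l K : nat)
    (gamma1 gamma2 : R) (mu : 'cV[R]_m) (Sigma U : 'M[R]_m) (lam : 'rV[R]_m)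
    (X : set 'cV[R]_n) (A : 'M[R]_(l, m)) (b : 'cV[R]_l)
    (y0 : 'I_K -> 'cV[R]_n -> R) (y : 'I_K -> 'cV[R]_n -> 'cV[R]_m)
    (m_gt0 : (0 < m)%N) (n_gt0 : (0 < n)%N) (l_gt0 : (0 < l)%N)
    (K_gt0 : (0 < K)%N) (K_le_m : (K <= m)%N)
    (gamma1_ge0 : 0 <= gamma1) (gamma2_ge1 : 1 <= gamma2)
    (Sigma_posdef : posdef Sigma)
    (U_orthogonal : U^T *m U = 1%:M)
    (lam_nonincr : forall i j : 'I_m, (i <= j)%N -> lam 0 j <= lam 0 i)
    (Sigma_eig : Sigma = U *m diag_mx lam *m U^T)
    (S_interior : interior (support_set A b) !=set0)
    (y0_affine : forall k, affine (y0 k : 'cV[R]_n -> R^o))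
    (y_affine : forall k, affine (y k)) :
  let dualized_L2 := dualized_value gamma1 gamma2 mu U lam X A b y0 y in
  let ThetaL2 := Theta_L2 gamma1 gamma2 mu U lam X A b y0 y in
  let ThetaM := Theta_M gamma1 gamma2 mu U lam X A b y0 y in
  [/\ forall m1 : nat, (0 < m1 <= K)%N -> dualized_L2 m1 = ThetaL2 m1,
      forall m1 : nat, (0 < m1 <= K)%N -> (ThetaL2 m1 <= ThetaM)%E,
      forall m1 m2 : nat, (0 < m1)%N -> (m1 < m2)%N -> (m2 <= K)%N ->
        (ThetaL2 m1 <= ThetaL2 m2)%E &
      ThetaL2 K = ThetaM].
Proof.
have g2 : 0 <= gamma2 by apply: le_trans gamma2_ge1.
have full := Theta_L2_full gamma1 mu U lam X A b y0 y
  (introT andP (conj K_gt0 K_le_m)) g2.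
split=> [m1 _|m1 /andP[_ m1K]|m1 m2 _ m12 m2K|]; last exact: full.
- apply: dualized_eq => //; apply: slater_point_exists S_interior _.
  exact: ULhalf_surj Sigma_posdef U_orthogonal Sigma_eig.
- by rewrite -full; apply: Theta_L2_monotone => //; rewrite m1K leqnn.
- by apply: Theta_L2_monotone => //; rewrite (ltnW m12) m2K.
Qed.
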